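(* Let $\Gamma$ be a finite simple graph and let $G$ be the right-angled Coxeter group with defining graph $\Gamma$. Suppose that $G$ is infinite. Then the spherical exponential growth rate $\alpha(G)$ of $G$ with respect to its standard set of generators $V\Gamma$ is either equal to $1$ or a Perron number.
   Context: The right-angled Coxeter group defined by a simple graph $\Gamma$ with vertex set $V\Gamma$ and edge set $E\Gamma$ is the group with presentation $$G=\langle v\in V\Gamma \mid v^2=1 \text{ for all } v\in V\Gamma,\ [u,v]=1 \text{ if } (u,v)\in E\Gamma\rangle .$$ Its standard generating set is $V\Gamma$. For a group $G$ with finite generating set $S$, the word-length of $g\in G$ is the minimum length of a word over $S\cup S^{-1}$ representing $g$. Let $a_l$ be the number of elements of $G$ of word-length $l$. The spherical exponential growth rate of $G$ with respect to $S$ is $\alpha(G)=\alpha(G,S)=\limsup_{l\to\infty}\sqrt[l]{a_l}$. A Perron number is a real algebraic integer bigger than $1$ which is strictly greater in absolute value than any of its other Galois conjugates. *)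

(* Defs.v *)
From HB Require Import structures.
From mathcomp Require Import all_boot all_order all_algebra.
From mathcomp Require Import finmap.
From mathcomp Require Import all_classical all_reals all_analysis.
From mathcomp Require Import complex.

Set Implicit Arguments.
Unset Strict Implicit.
Unset Printing Implicit Defensive.

Import Order.TTheory GRing.Theory Num.Theory.

Local Open Scope classical_set_scope.

(* The letter (v, false) stands for the generator v and (v, true) for its     *)
(* formal inverse; w ++ w' is the product of words.                           *)
Notation letter T := (T * bool)%type.
Notation gword T := (seq (letter T)).

Definition letter_inv (T : Type) (a : letter T) : letter T := (a.1, ~~ a.2).
Definition gword_inv (T : Type) (w : gword T) : gword T :=
  rev (map (@letter_inv T) w).

Section Presentation.
Variables (T : choiceType) (rels : set (gword T)).

(* Equality in the group < T | r = 1 for all r in rels >. *)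
Inductive pres_eq : gword T -> gword T -> Prop :=
| pres_refl w : pres_eq w w
| pres_sym w w' : pres_eq w w' -> pres_eq w' w
| pres_trans w2 w1 w3 : pres_eq w1 w2 -> pres_eq w2 w3 -> pres_eq w1 w3
| pres_cat w1 w1' w2 w2' :
    pres_eq w1 w1' -> pres_eq w2 w2' -> pres_eq (w1 ++ w2) (w1' ++ w2')
| pres_cancel a : pres_eq [:: a; letter_inv a] [::]
| pres_rel r : rels r -> pres_eq r [::].

Definition pres_eqb : rel (gword T) := fun w w' => `[< pres_eq w w' >].

Lemma pres_eqb_refl : reflexive pres_eqb.
Proof. by move=> w; apply/asboolP/pres_refl. Qed.

Lemma pres_eqb_sym : symmetric pres_eqb.
Proof.
by move=> w w'; apply/asboolP/asboolP => h; exact: pres_sym.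
Qed.

Lemma pres_eqb_trans : transitive pres_eqb.
Proof.
by move=> w2 w1 w3 /asboolP h /asboolP h'; apply/asboolP/(pres_trans h h').
Qed.

Canonical pres_equiv := EquivRel pres_eqb pres_eqb_refl pres_eqb_sym
  pres_eqb_trans.

Definition pres_group : Type := {eq_quot pres_equiv}%qT.
HB.instance Definition _ := Choice.on pres_group.

Definition pres_class (w : gword T) : pres_group := (\pi_{eq_quot pres_equiv} w)%qT.
Definition pres_repr (g : pres_group) : gword T := repr (g : {eq_quot pres_equiv}%qT).

Lemma pres_classP w w' : pres_class w = pres_class w' <-> pres_eq w w'.
Proof.
split=> [/eqP|h]; first by rewrite /pres_class eqmodE => /asboolP.
by apply/eqP; rewrite /pres_class eqmodE; apply/asboolP.
Qed.

Lemma pres_reprK g : pres_class (pres_repr g) = g.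
Proof. exact: reprK. Qed.

Lemma pres_reprP w : pres_eq (pres_repr (pres_class w)) w.
Proof. by apply/pres_classP; rewrite pres_reprK. Qed.

Lemma letter_invK : involutive (@letter_inv T).
Proof. by case=> a b; rewrite /letter_inv /= negbK. Qed.

Lemma pres_invr w : pres_eq (w ++ gword_inv w) [::].
Proof.
elim: w => [|a w IH]; first exact: pres_refl.
rewrite /gword_inv map_cons rev_cons -cats1 -cat1s -catA (catA w).
apply: (@pres_trans ([:: a] ++ [::] ++ [:: letter_inv a])); last exact: pres_cancel.
by apply: pres_cat; [exact: pres_refl|apply: pres_cat; [|exact: pres_refl]].
Qed.

Lemma gword_invK : involutive (@gword_inv T).
Proof.
by move=> w; rewrite /gword_inv map_rev revK -map_comp (eq_map letter_invK) map_id.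
Qed.

Lemma pres_invl w : pres_eq (gword_inv w ++ w) [::].
Proof. by rewrite -{2}(gword_invK w); exact: pres_invr. Qed.

Lemma pres_inv w w' : pres_eq w w' -> pres_eq (gword_inv w) (gword_inv w').
Proof.
move=> h; apply: (@pres_trans (gword_inv w ++ w' ++ gword_inv w')).
  rewrite -{1}(cats0 (gword_inv w)); apply: pres_cat; first exact: pres_refl.
  exact/pres_sym/pres_invr.
rewrite catA -{2}(cat0s (gword_inv w')); apply: pres_cat; last exact: pres_refl.
apply: pres_trans (pres_invl w); apply: pres_cat; first exact: pres_refl.
exact: pres_sym.
Qed.

Definition pres_one : pres_group := pres_class [::].
Definition pres_mul (g h : pres_group) : pres_group :=
  pres_class (pres_repr g ++ pres_repr h).
Definition pres_invg (g : pres_group) : pres_group :=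
  pres_class (gword_inv (pres_repr g)).

Lemma pres_mulE w w' : pres_mul (pres_class w) (pres_class w') = pres_class (w ++ w').
Proof. by apply/pres_classP; apply: pres_cat; exact: pres_reprP. Qed.

Lemma pres_invE w : pres_invg (pres_class w) = pres_class (gword_inv w).
Proof. by apply/pres_classP; apply: pres_inv; exact: pres_reprP. Qed.

Lemma pres_mulA : associative pres_mul.
Proof.
move=> x y z; rewrite -(pres_reprK x) -(pres_reprK y) -(pres_reprK z).
by rewrite !pres_mulE catA.
Qed.

Lemma pres_mul1 : left_id pres_one pres_mul.
Proof. by move=> x; rewrite -(pres_reprK x) pres_mulE. Qed.

Lemma pres_mulr1 : right_id pres_one pres_mul.
Proof. by move=> x; rewrite -(pres_reprK x) pres_mulE cats0. Qed.

Lemma pres_mulV : left_inverse pres_one pres_invg pres_mul.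
Proof.
move=> x; rewrite -(pres_reprK x) pres_invE pres_mulE.
exact/pres_classP/pres_invl.
Qed.

Lemma pres_mulrV : right_inverse pres_one pres_invg pres_mul.
Proof.
move=> x; rewrite -(pres_reprK x) pres_invE pres_mulE.
exact/pres_classP/pres_invr.
Qed.

HB.instance Definition _ := isGroup.Build pres_group
  pres_mulA pres_mul1 pres_mulr1 pres_mulV pres_mulrV.

Definition pres_gen (v : T) : pres_group := pres_class [:: (v, false)].

End Presentation.

(* The letters v and v^-1 are distinct before imposing the relators v^2.      *)
Definition racg_rels (V : finType) (e : rel V) : set (gword V) :=
  [set w | (exists v, w = [:: (v, false); (v, false)]) \/
           (exists u v, e u v /\
              w = [:: (u, false); (v, false); (u, true); (v, true)])].

Definition racg (V : finType) (e : rel V) : groupType :=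
  pres_group (racg_rels e).

Definition racg_gens (V : finType) (e : rel V) : set (racg e) :=
  range (@pres_gen V (racg_rels e)).
Arguments racg_gens {V} e _.

Section Growth.
Variables (G : groupType) (S : set G).
Local Open Scope group_scope.

Definition word_over (w : seq G) : Prop :=
  forall x, x \in w -> S x \/ S x^-1.

Definition represents (w : seq G) (g : G) : Prop :=
  word_over w /\ \prod_(x <- w) x = g.

Definition has_word_length (g : G) (l : nat) : Prop :=
  (exists2 w, represents w g & size w = l) /\
  (forall w, represents w g -> (l <= size w)%N).

Definition sphere (l : nat) : set G := [set g | has_word_length g l].

(* Spheres are finite when S is; fset_set sends an infinite set to fset0.     *)
Definition sphere_card (l : nat) : nat := #|` fset_set (sphere l)|.

End Growth.

Local Open Scope ring_scope.

(* The value at l = 0 is 1 by the convention 0^-1 = 0; it does not affect the *)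
(* limit superior.                                                            *)
Definition growth_rate (R : realType) (G : groupType) (S : set G) : \bar R :=
  limn_esup (fun l : nat => ((sphere_card S l)%:R `^ (l%:R^-1) : R)%:E).

Definition algebraic_integer (F : nzRingType) (x : F) : Prop :=
  exists2 p : {poly int}, p \is monic & root (map_poly intr p) x.

Definition min_poly_of (F : unitRingType) (p : {poly rat}) (x : F) : Prop :=
  [/\ p \is monic, irreducible_poly p & root (map_poly ratr p) x].

Definition galois_conjugate (F : unitRingType) (x y : F) : Prop :=
  exists2 p : {poly rat}, min_poly_of p x & root (map_poly ratr p) y.

Definition perron (R : realType) (x : R) : Prop :=
  [/\ 1 < x, algebraic_integer x &
      forall z : R[i], galois_conjugate (x%:C)%C z -> z != (x%:C)%C ->
        `|z| < `|(x%:C)%C| ].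

(* Main.v *)
Require Import Defs.
From HB Require Import structures.
From mathcomp Require Import all_boot all_order all_algebra.
From mathcomp Require Import finmap.
From mathcomp Require Import all_classical all_reals all_analysis.
From mathcomp Require Import complex polyrcf.
From mathcomp Require Import zify ring lra.

(** Write a_l for the number of elements of word-length l, W(t) for the power
series with coefficients a_l, and, for a set A of vertices,
q_A(x) = sum over the cliques C contained in A of (-x)^|C| ([clique_sum]).

Counting. The group acts on finite sets of pieces (vertex, level): a
generator v is dropped on top of the pieces that do not commute with it, and
annihilates a copy of itself lying at the same place ([push]).  Word-length is
the number of pieces of the resulting heap ([has_word_lengthP]), and the right
descents of an element (the generators that shorten it) can be read off its
heap: they commute pairwise ([descents_commute]), and multiplying by a
generator u does not change whether a generator commuting with u is a descent
([descent_push_comm]).  Inclusion-exclusion over the sets of descents then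
gives W(t) q_V(t/(1+t)) = 1, that is W(t) D(t) = (1+t)^|V| where
D(t) = (1+t)^|V| q_V(t/(1+t)) is a polynomial ([growth_series]).  A sequence
whose product with D is a polynomial grows at most like the inverse of the
least modulus of a root of D ([conv_bound]); when that polynomial has
nonnegative coefficients, like (1+t)^|V|, and constant term 1, it grows at least
like 1/rho for every positive root rho of D ([conv_root_lower]).

Domination.  Splitting the cliques of A according to a vertex v with link L in
A - v gives q_A = q_(A-v) - x q_L ([clique_sum_del]).  At x = t/(1+t), with
W_A = 1/q_A, this reads W_A = W_(A-v) (1+t)/(1-F) where
F = t (W_(A-v)/W_L - 1).  By induction every quotient W_A/W_B with B a subset
of A is 1 plus a series with nonnegative coefficients, so that its value at a
complex z is bounded by its value at any r >= |z|.  Series can be avoided: the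
bound is a statement about the two values at z and r, that is about the pair
(z, r) in a product ring, and the pairs (w, s) with |w| <= s are closed under
sums, products and geometric series ([dominated_ratio]).  In particular D has
no root in a disc |z| < rho <= 1 such that every q_A(t/(1+t)) is positive for
0 <= t < rho ([series_denom_root_ge]).

Conclusion.  Let rho be the least t in (0,1) at which some q_A(t/(1+t))
vanishes ([least_root]).  If there is none, D has no root in the open unit
disc and the growth rate is 1.  Otherwise vanishing at rho passes from A to
larger sets ([zero_upward]), so that D(rho) = 0 and the growth rate is
alpha = 1/rho.  Choose A minimal such that q_A vanishes at rho.  A zero z of
q_A(t/(1+t)) with |z| <= rho satisfies F(z) = 1 = F(rho), where F - t^2 - t^3 is again
dominated because no vertex of A, and no pair of vertices of A, commutes with
all the others; hence |1+z| >= 1+rho and z = rho ([unique_zero]).  Finally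
(1+y)^|A| q_A(1/(1+y)) is a monic integer polynomial with root alpha
([recurrence_poly]), so that the conjugates of alpha are among its roots, and
those of modulus at least alpha reduce to alpha ([perron_inv_zero]). *)

Set Implicit Arguments.
Unset Strict Implicit.
Unset Printing Implicit Defensive.

Import Order.TTheory GRing.Theory Num.Theory.

(** * Heaps of pieces *)

Section Heaps.
Variables (V : finType) (e : rel V).
Hypotheses (e_sym : symmetric e) (e_irr : irreflexive e).

Local Open Scope fset_scope.
Local Open Scope nat_scope.

Definition blocks (u v : V) : bool := (u != v) && ~~ e u v.

Lemma blocks_sym : symmetric blocks.
Proof. by move=> u v; rewrite /blocks eq_sym e_sym. Qed.

Lemma blocks_irr v : blocks v v = false.
Proof. by rewrite /blocks eqxx. Qed.

(** Levels start at 1, so that 0 stands for an empty pile. *)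
Definition height (v : V) (h : {fset V * nat}) : nat :=
  \max_(p <- h) (if blocks v p.1 then p.2 else 0).

Definition slot (v : V) (h : {fset V * nat}) : V * nat := (v, (height v h).+1).

(** Adding or removing the piece at [slot v h] is the same operation, a
symmetric difference ([mem_push]).  The slot of [v] ignores the pieces that do
not block [v]; this is what makes the defining relations of the group hold on
arbitrary finite sets of pieces, stacked correctly or not. *)
Definition push (h : {fset V * nat}) (v : V) : {fset V * nat} :=
  if slot v h \in h then h `\ slot v h else slot v h |` h.

Lemma height_push u v h : ~~ blocks v u -> height v (push h u) = height v h.
Proof.
move=> /negPf b; rewrite /push /height; case: ifPn => hin.
  by rewrite [RHS](big_fsetD1 (slot u h)) //= b max0n.
by rewrite big_fsetU1 //= b max0n.
Qed.

Lemma height_push_blocked u v h :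
  blocks v u -> slot u h \notin h -> height u h < height v (push h u).
Proof. by move=> b hin; rewrite /push (negPf hin) /height big_fsetU1 //= b leq_maxl. Qed.

Lemma leq_height u v k h : blocks v u -> (u, k) \in h -> k <= height v h.
Proof.
by move=> b hin; rewrite /height (big_fsetD1 (u, k)) //= b leq_maxl.
Qed.

Lemma slot_push u v h : ~~ blocks v u -> slot v (push h u) = slot v h.
Proof. by move=> b; rewrite /slot height_push. Qed.

Lemma mem_push h u p :
  (p \in push h u) = (p \in h) (+) (p == slot u h).
Proof.
rewrite /push; case: ifPn => hin; rewrite !inE.
  by case: eqP => [->|_]; rewrite ?hin //= addbF.
by case: eqP => [->|_]; rewrite ?(negPf hin) //= addbF.
Qed.

Lemma pushK v : involutive (push^~ v).
Proof.
move=> h; apply/fsetP => p.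
by rewrite !mem_push slot_push ?blocks_irr // -addbA addbb addbF.
Qed.

Lemma pushC u v h : e u v -> push (push h u) v = push (push h v) u.
Proof.
move=> euv; apply/fsetP => p; rewrite !mem_push !slot_push /blocks.
- by rewrite -!addbA (addbC (p == _)).
- by rewrite negb_and negbK euv orbT.
- by rewrite negb_and negbK e_sym euv orbT.
Qed.

Definition descent (v : V) (h : {fset V * nat}) : bool := slot v h \in h.

Lemma card_push h v :
  #|` push h v| = if descent v h then #|` h|.-1 else #|` h|.+1.
Proof.
rewrite /push /descent; case: ifPn => hin.
  by rewrite (cardfsD1 (slot v h) h) hin.
by rewrite cardfsU1 hin.
Qed.

Lemma card_descent h v : descent v h -> 0 < #|` h|.
Proof. by move=> d; rewrite cardfs_gt0; apply/fset0Pn; exists (slot v h). Qed.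

Lemma descent_push_self h v : descent v (push h v) = ~~ descent v h.
Proof. by rewrite /descent slot_push ?blocks_irr // mem_push eqxx addbT. Qed.

Lemma descent_push_comm h u v : e u v -> descent v (push h u) = descent v h.
Proof.
move=> euv; rewrite /descent slot_push; last first.
  by rewrite /blocks e_sym euv andbF.
rewrite mem_push [_ == _]negbTE ?addbF //.
by apply: contraTN euv => /eqP [-> _]; rewrite e_irr.
Qed.

(** If neither commutes, each piece has to lie strictly above the other. *)
Lemma descents_commute h u v :
  u != v -> descent u h -> descent v h -> e u v.
Proof.
move=> uv du dv; apply/negPn/negP => neuv.
have b : blocks u v by rewrite /blocks uv.
have := leq_height b dv; rewrite blocks_sym in b.
have := leq_height b du; lia.
Qed.

Definition heap (s : seq V) : {fset V * nat} := foldl push fset0 s.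

Lemma heap_nil : heap [::] = fset0. Proof. by []. Qed.

Lemma heap_rcons s v : heap (rcons s v) = push (heap s) v.
Proof. by rewrite /heap -cats1 foldl_cat. Qed.

Lemma card_heap s : #|` heap s| <= size s.
Proof.
elim/last_ind: s => [|s v IH]; first by rewrite heap_nil cardfs0.
rewrite heap_rcons card_push size_rcons; case: ifP => _ //.
by rewrite (leq_trans (leq_pred _)) // (leq_trans IH).
Qed.

End Heaps.

(** * Word-length in a right-angled Coxeter group *)

Section Racg.
Variables (V : finType) (e : rel V).
Hypotheses (e_sym : symmetric e) (e_irr : irreflexive e).
Local Notation G := (racg e).
Local Notation gen := (@pres_gen V (racg_rels e) : V -> G).
Local Notation S := (racg_gens e).

Local Open Scope group_scope.

Local Notation class := (@pres_class V (racg_rels e) : gword V -> G).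

Lemma class_mul w w' : class w * class w' = class (w ++ w').
Proof. exact: pres_mulE. Qed.

Lemma class_inv w : (class w)^-1 = class (gword_inv w).
Proof. exact: pres_invE. Qed.

Lemma gen_sqr v : gen v * gen v = 1.
Proof.
rewrite class_mul; apply/pres_classP/pres_rel.
by left; exists v.
Qed.

Lemma gen_inv v : (gen v)^-1 = gen v.
Proof. by apply: (mulgI (gen v)); rewrite mulgV gen_sqr. Qed.

Lemma gen_comm u v : e u v -> gen u * gen v = gen v * gen u.
Proof.
move=> euv.
have h : gen u * gen v * (gen u)^-1 * (gen v)^-1 = 1.
  rewrite /pres_gen !class_inv (class_mul [:: _] [:: _]).
  rewrite (class_mul (_ ++ _)) (class_mul (_ ++ _)).
  by apply/pres_classP/pres_rel; right; exists u, v.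
move: h; rewrite !gen_inv => h.
have : gen u * gen v * gen u * gen v * (gen v * gen u) = gen v * gen u.
  by rewrite h mul1g.
by rewrite -!mulgA (mulgA (gen v) (gen v)) gen_sqr mul1g gen_sqr mulg1.
Qed.

Definition eval_word (s : seq V) : G := \prod_(v <- s) gen v.

Lemma eval_word_rcons s v : eval_word (rcons s v) = eval_word s * gen v.
Proof. by rewrite /eval_word big_rcons. Qed.

Lemma eval_word_class (w : gword V) :
  class w = eval_word [seq a.1 | a <- w].
Proof.
elim: w => [|a w IH]; first by rewrite /eval_word big_nil.
rewrite -cat1s -class_mul IH /= /eval_word big_cons; congr (_ * _).
case: a => v []; last by [].
by rewrite -gen_inv class_inv.
Qed.

Lemma eval_word_surj g : exists s, eval_word s = g.
Proof.
exists [seq a.1 | a <- pres_repr g].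
by rewrite -eval_word_class pres_reprK.
Qed.

(** The defining relations hold for the action on heaps. *)
Lemma foldl_push_pres w w' (h : {fset V * nat}) :
  pres_eq (racg_rels e) w w' ->
  foldl (push e) h [seq a.1 | a <- w] = foldl (push e) h [seq a.1 | a <- w'].
Proof.
move=> E; elim: E h => {w w'} //=.
- by move=> w2 w1 w3 _ IH1 _ IH2 h; rewrite IH1.
- by move=> w1 w1' w2 w2' _ IH1 _ IH2 h; rewrite !map_cat !foldl_cat IH1 IH2.
- by move=> a h; rewrite pushK.
- move=> r [[v ->]|[u [v [euv ->]]]] h /=; first by rewrite pushK.
  by rewrite (pushC e_sym _ euv) pushK pushK.
Qed.

Definition heap_of (g : G) : {fset V * nat} :=
  heap e [seq a.1 | a <- pres_repr g].

Lemma heap_of_word s : heap_of (eval_word s) = heap e s.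
Proof.
have Es : s = [seq a.1 | a <- [seq (v, false) | v <- s]].
  by rewrite -map_comp map_id.
rewrite {1}Es -eval_word_class /heap_of /heap [in RHS]Es.
exact/foldl_push_pres/pres_reprP.
Qed.

Lemma heap_of_mul g v : heap_of (g * gen v) = push e (heap_of g) v.
Proof.
by have [s <-] := eval_word_surj g; rewrite -eval_word_rcons !heap_of_word heap_rcons.
Qed.

Lemma heap_of1 : heap_of 1 = fset0.
Proof.
have -> : 1 = eval_word [::] by rewrite /eval_word big_nil.
by rewrite heap_of_word.
Qed.

Definition len (g : G) : nat := #|` heap_of g|.

(** A form of the exchange condition: a descent can be moved to the end of a
reduced word.  If the last letter [u] commutes with [v], the descent is already
one of the shorter word; if it does not, the piece of [u] lies above every
piece that could be removed by [v], so that [v] is no descent. *)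
Lemma reduced_descent s v :
  #|` heap e s| = size s -> descent e v (heap e s) ->
  exists2 s', eval_word s = eval_word s' * gen v & (size s').+1 = size s.
Proof.
elim/last_ind: s => [|s u IH] in v *.
  by move=> _ /card_descent; rewrite heap_nil cardfs0.
rewrite heap_rcons size_rcons card_push.
case: ifPn => [du|ndu].
  have := card_heap e s; have := card_descent du; lia.
move=> [red]; have [<-|uv] := eqVneq u v.
  by exists s => //; rewrite eval_word_rcons.
have [euv|neuv] := boolP (e u v).
  rewrite descent_push_comm // => dv.
  have [s' Es' sz] := IH v red dv.
  exists (rcons s' u); last by rewrite size_rcons sz.
  by rewrite !eval_word_rcons Es' -!mulgA (gen_comm euv).
have b : blocks e v u by rewrite blocks_sym // /blocks uv.
rewrite /descent mem_push => d.
have d' : slot e v (push e (heap e s) u) \in heap e s.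
  move: d; rewrite [_ == slot e u _]negbTE ?addbF //.
  by apply: contraNN uv => /eqP [-> _].
have b' : blocks e u v by rewrite blocks_sym.
have := height_push_blocked b ndu; have := leq_height b' d'; lia.
Qed.

(** When the next letter removes a piece, [reduced_descent] exhibits that letter
at the end of the word, where it cancels. *)
Lemma reduced_word g : exists2 s, eval_word s = g & size s = len g.
Proof.
have [s <-] := eval_word_surj g.
elim/last_ind: s => [|s v [s' Es' sz]].
  by exists [::] => //; rewrite /len heap_of_word heap_nil cardfs0.
have red : #|` heap e s'| = size s' by rewrite sz -Es' /len heap_of_word.
rewrite eval_word_rcons -Es'.
have [d|nd] := boolP (descent e v (heap e s')).
  have [s2 Es2 sz2] := reduced_descent red d.
  exists s2; first by rewrite Es2 -mulgA gen_sqr mulg1.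
  by rewrite -eval_word_rcons /len heap_of_word heap_rcons card_push d red -sz2.
exists (rcons s' v); first by rewrite eval_word_rcons.
rewrite -eval_word_rcons /len heap_of_word heap_rcons card_push (negPf nd).
by rewrite red size_rcons.
Qed.

Lemma word_over_eval (w : seq G) :
  word_over S w -> exists2 s, eval_word s = \prod_(x <- w) x & size s = size w.
Proof.
elim: w => [|x w IH] wo; first by exists [::] => //; rewrite /eval_word !big_nil.
have [|s Es sz] := IH.
  by move=> y yw; apply: wo; rewrite inE yw orbT.
have [v Ev] : exists v, gen v = x.
  have [] := wo x (mem_head _ _); first by case=> v _ <-; exists v.
  by case=> v _ Ev; exists v; rewrite -[RHS]invgK -gen_inv Ev.
by exists (v :: s); [rewrite /eval_word !big_cons Ev -Es | rewrite /= sz].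
Qed.

Lemma has_word_lengthP g l : has_word_length S g l <-> len g = l.
Proof.
have le_size w : represents S w g -> (len g <= size w)%N.
  by case=> /word_over_eval [s <- <-] <-; rewrite /len heap_of_word card_heap.
have ex : exists2 w, represents S w g & size w = len g.
  have [s Es sz] := reduced_word g.
  exists [seq gen v | v <- s]; last by rewrite size_map.
  split; last by rewrite big_map.
  by move=> x /mapP [v _ ->]; left; exists v.
split=> [[[w rw <-] le_l]|<-]; last by split.
apply/eqP; rewrite eqn_leq le_size //=.
by have [w' rw' <-] := ex; exact: le_l.
Qed.

End Racg.

(** * Clique polynomials *)

Local Open Scope ring_scope.

Section CliqueSums.
Variables (V : finType) (e : rel V).
Hypothesis e_sym : symmetric e.

Definition clique (C : {set V}) : bool :=
  [forall u in C, forall v in C, (u != v) ==> e u v].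

Lemma cliqueP (C : {set V}) :
  reflect {in C &, forall u v, u != v -> e u v} (clique C).
Proof.
apply: (iffP forall_inP) => [cl u v uC vC uv|cl u uC].
  by move/forall_inP: (cl u uC) => /(_ v vC) /implyP; apply.
by apply/forall_inP => v vC; apply/implyP => uv; exact: cl.
Qed.

Definition link (v : V) : {set V} := [set u | e v u].

Definition clique_sum (K : comPzRingType) (A : {set V}) (x : K) : K :=
  \sum_(C : {set V} | (C \subset A) && clique C) (- x) ^+ #|C|.

(** The homogeneous version of [clique_sum]: it produces the polynomials
attached to [A] in either of the variables t and 1/t without denominators. *)
Definition clique_form (K : comPzRingType) (A : {set V}) (x y : K) : K :=
  \sum_(C : {set V} | (C \subset A) && clique C)
    (- x) ^+ #|C| * y ^+ (#|A| - #|C|).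

Lemma clique0 : clique finset.set0.
Proof. by apply/cliqueP => u v; rewrite inE. Qed.

Lemma clique_setU1 v (C : {set V}) :
  v \notin C -> clique (v |: C) = (C \subset link v) && clique C.
Proof.
move=> vC; apply/cliqueP/andP => [cl|[/fintype.subsetP Cl /cliqueP cl] u w].
  split; last by apply/cliqueP => u w uC wC; apply: cl; rewrite !inE ?uC ?wC orbT.
  apply/fintype.subsetP => u uC; rewrite inE; apply: cl; rewrite ?inE ?eqxx ?uC ?orbT //.
  by apply: contraNneq vC => ->.
rewrite !inE => /orP [/eqP ->|uC] /orP [/eqP ->|wC]; rewrite ?eqxx // => uw.
- by have := Cl _ wC; rewrite inE.
- by have := Cl _ uC; rewrite inE e_sym.
- exact: cl.
Qed.

Lemma clique_sum0 (K : comPzRingType) (x : K) : clique_sum finset.set0 x = 1.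
Proof.
rewrite /clique_sum (big_pred1 finset.set0) ?cards0 // => C.
rewrite /= finset.subset0; case: eqP => // ->; exact: clique0.
Qed.

(** The cliques containing [v] are the [v |: C] with [C] a clique in the link
of [v]. *)
Lemma clique_sum_del (K : comPzRingType) (A : {set V}) v (x : K) : v \in A ->
  clique_sum A x = clique_sum (A :\ v) x - x * clique_sum ((A :\ v) :&: link v) x.
Proof.
move=> vA; rewrite /clique_sum (bigID (fun C : {set V} => v \notin C)) /=.
congr (_ + _).
  apply: eq_bigl => C; rewrite finset.subsetD1; case: (v \in C); rewrite ?andbF ?andbT //.
rewrite -mulNr big_distrr /=.
rewrite (reindex_onto (fun C : {set V} => v |: C) (fun C => C :\ v)) /=; last first.
  by move=> C; rewrite negbK => /andP [_ vC]; rewrite finset.setD1K.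
apply: eq_big => C.
  rewrite finset.setU11 andbT finset.subsetI subsetD1 finset.subUset finset.sub1set vA /=.
  have [vC|vC] := boolP (v \in C).
    rewrite !andbF /=; apply/negbTE; rewrite negb_and; apply/orP; right.
    by apply: contraTneq vC => <-; rewrite !inE eqxx.
  by rewrite clique_setU1 // finset.setU1K // eqxx !andbT -andbA.
move=> /andP [_ /eqP E]; have vC : v \notin C by rewrite -E !inE eqxx.
by rewrite cardsU1 vC add1n exprS.
Qed.

Lemma rmorph_clique_sum (K K' : comPzRingType) (f : {rmorphism K -> K'}) A x :
  f (clique_sum A x) = clique_sum A (f x).
Proof. by rewrite rmorph_sum; apply: eq_bigr => C _; rewrite rmorphXn rmorphN. Qed.

Lemma rmorph_clique_form (K K' : comPzRingType) (f : {rmorphism K -> K'}) A x y :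
  f (clique_form A x y) = clique_form A (f x) (f y).
Proof.
rewrite rmorph_sum; apply: eq_bigr => C _.
by rewrite rmorphM !rmorphXn rmorphN.
Qed.

Lemma clique_formE (K : fieldType) A (x y : K) : y != 0 ->
  clique_form A x y = y ^+ #|A| * clique_sum A (x / y).
Proof.
move=> y0; rewrite big_distrr /=; apply: eq_bigr => C /andP [/subset_leq_card CA _].
by rewrite -mulNr expr_div_n mulrCA -expfB_cond // (negPf y0).
Qed.

(** In a clique, deleting a vertex and passing to its link leave the same set,
so that the two terms of [clique_sum_del] cancel at 1.  This is the alternating
sum over the subsets of a finite set. *)
Lemma clique_sum1 (K : comPzRingType) (C : {set V}) :
  clique C -> clique_sum C (1 : K) = (C == finset.set0)%:R.
Proof.
move=> cl; have [->|/finset.set0Pn [v vC]] := eqVneq; first by rewrite clique_sum0.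
rewrite (clique_sum_del _ vC) mul1r (finset.setIidPl _) ?subrr //.
have := cl; rewrite -{1}(finset.setD1K vC) clique_setU1 ?inE ?eqxx //.
by case/andP.
Qed.

End CliqueSums.

(** * Polynomials acting on sequences *)

Section Convolution.
Variable K : comNzRingType.
Implicit Types (p q : {poly K}) (a b : nat -> K).

(** The coefficients of the product of [p] with the power series of
coefficients [a]; only the terms of index at most [l] matter for the
coefficient [l]. *)
Definition conv p a (l : nat) : K := (p * \poly_(i < l.+1) a i)`_l.

Lemma conv_trunc p a l N : (l < N)%N -> conv p a l = (p * \poly_(i < N) a i)`_l.
Proof.
move=> lN; rewrite /conv !coefM; apply: eq_bigr => i _.
by rewrite !coef_poly ltnS leq_subr (leq_ltn_trans (leq_subr _ _) lN).
Qed.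

Lemma convM p q a l : conv (p * q) a l = conv p (conv q a) l.
Proof.
rewrite /conv -mulrA !(coefM p); apply: eq_bigr => i _; congr (_ * _).
rewrite [in RHS]coef_poly ltnS leq_subr; apply/esym/conv_trunc.
by rewrite ltnS leq_subr.
Qed.

Lemma eq_conv p a b l : (forall i, (i <= l)%N -> a i = b i) -> conv p a l = conv p b l.
Proof.
move=> E; rewrite /conv !coefM; apply: eq_bigr => i _.
by rewrite !coef_poly ltnS leq_subr E // leq_subr.
Qed.

Lemma convDl p q a l : conv (p + q) a l = conv p a l + conv q a l.
Proof. by rewrite /conv mulrDl coefD. Qed.

Lemma conv0 a l : conv 0 a l = 0.
Proof. by rewrite /conv mul0r coef0. Qed.

Lemma conv_suml (I : Type) (r : seq I) (P : pred I) (F : I -> {poly K}) a l :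
  conv (\sum_(i <- r | P i) F i) a l = \sum_(i <- r | P i) conv (F i) a l.
Proof. by rewrite /conv mulr_suml coef_sum. Qed.

Lemma conv_sumr (I : Type) (r : seq I) (P : pred I) p (F : I -> nat -> K) l :
  conv p (fun n => \sum_(i <- r | P i) F i n) l = \sum_(i <- r | P i) conv p (F i) l.
Proof.
rewrite /conv coefM.
under eq_bigr => j _ do rewrite coef_poly ltnS leq_subr mulr_sumr.
rewrite exchange_big; apply: eq_bigr => i _; rewrite coefM; apply: eq_bigr => j _.
by rewrite coef_poly ltnS leq_subr.
Qed.

Lemma convC (c : K) a l : conv c%:P a l = c * a l.
Proof. by rewrite /conv coefCM coef_poly ltnSn. Qed.

Lemma convX a l : conv 'X a l = if l is l'.+1 then a l' else 0.
Proof. by rewrite /conv coefXM coef_poly; case: l => //= l; rewrite ltnS leqnSn. Qed.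

Lemma conv_delta p l : conv p (fun n => (n == 0%N)%:R) l = p`_l.
Proof.
rewrite /conv [X in p * X](_ : _ = 1) ?mulr1 //.
by apply/polyP => i; rewrite coef_poly coef1; case: i => //= i; case: ifP.
Qed.

End Convolution.

(** * The growth series *)

Section Counting.
Variables (V : finType) (e : rel V).
Hypotheses (e_sym : symmetric e) (e_irr : irreflexive e).
Local Notation G := (racg e).
Local Notation gen := (@pres_gen V (racg_rels e) : V -> G).
Local Notation S := (racg_gens e).

Lemma finite_sphere l : finite_set (sphere S l).
Proof.
apply: (@sub_finite_set _ _ ((fun t : l.-tuple V => eval_word e t) @` setT)%classic).
  move=> g /(has_word_lengthP e_sym e_irr) lg.
  have [s Es sz] := reduced_word e_sym e_irr g.
  have szl : size s == l by rewrite sz lg.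
  by exists (Tuple szl).
exact/finite_image/finite_finset.
Qed.

Lemma in_sphere l g : (g \in fset_set (sphere S l)) = (len g == l).
Proof.
rewrite in_fset_set; last exact: finite_sphere.
by apply/idP/eqP; rewrite inE => /has_word_lengthP; apply.
Qed.

Definition descents (g : G) : {set V} := [set v | descent e v (heap_of g)].

Lemma clique_descents g : clique e (descents g).
Proof.
apply/cliqueP => u v; rewrite !inE => du dv uv.
exact: (descents_commute e_sym uv du dv).
Qed.

Lemma descents_eq0 g : (descents g == finset.set0) = (len g == 0%N).
Proof.
apply/eqP/eqP => [D0|].
  have [s Es sz] := reduced_word e_sym e_irr g.
  case/lastP: s => [|s v] in Es sz *; first by rewrite -sz.
  suff : v \in descents g by rewrite D0 inE.
  rewrite inE -Es eval_word_rcons heap_of_mul // descent_push_self heap_of_word //.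
  apply/negP => d.
  move: sz; rewrite -Es /len heap_of_word // heap_rcons card_push d size_rcons.
  have := card_descent d; have := card_heap e s; lia.
move=> l0; apply/finset.setP => v; rewrite !inE; apply/negbTE/negP => /card_descent.
by rewrite -/(len g) l0.
Qed.

Lemma len_mul_gen g v :
  len (g * gen v)%g = if v \in descents g then (len g).-1 else (len g).+1.
Proof. by rewrite /len heap_of_mul // card_push inE. Qed.

Lemma descents_mul_gen g v u :
  (u == v) || e v u ->
  (u \in descents (g * gen v)%g) = (u == v) (+) (u \in descents g).
Proof.
rewrite !inE heap_of_mul //; have [->|uv] := eqVneq u v.
  by move=> _; rewrite descent_push_self.
by move=> /= evu; rewrite descent_push_comm.
Qed.

Definition desc_sphere (T : {set V}) (l : nat) : {fset G} :=
  [fset g in fset_set (sphere S l) | T \subset descents g]%fset.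

Lemma in_desc_sphere T l g :
  (g \in desc_sphere T l) = (len g == l) && (T \subset descents g).
Proof. by rewrite !inE /= in_sphere. Qed.

(** Right multiplication by [v] exchanges the elements having [v] as a descent
with those that do not, shifting the length by one; as [v] commutes with all of
[T], it preserves the condition that [T] consists of descents. *)
Lemma card_desc_sphere_setU1 (T : {set V}) v l : v \notin T -> clique e (v |: T) ->
  #|` desc_sphere T l| = (#|` desc_sphere (v |: T) l| + #|` desc_sphere (v |: T) l.+1|)%N.
Proof.
move=> vT cl; rewrite -(cardfsID (desc_sphere (v |: T) l)).
congr (_ + _)%N.
  congr (#|` _|); apply/fsetP => g; rewrite in_fsetI !in_desc_sphere finset.subUset.
  by case: (len g == l); case: (T \subset _); rewrite ?andbF.
pose f (g : G) : G := (g * gen v)%g.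
have f_inj : injective f by exact: mulIg.
have fK : involutive f by move=> g; rewrite /f -mulgA gen_sqr mulg1.
set X := (desc_sphere T l `\` _)%fset.
have <- : #|` [fset f x | x in X]%fset| = #|` X| by exact: card_imfset.
congr (#|` _|); apply/fsetP => g.
have Tl u : u \in T -> (u == v) = false /\ e v u.
  move=> uT; split; first by apply: contraNF vT => /eqP <-.
  have := cl; rewrite clique_setU1 // => /andP [/fintype.subsetP /(_ _ uT)].
  by rewrite inE.
have subf h : (T \subset descents (f h)) = (T \subset descents h).
  apply/fintype.subsetP/fintype.subsetP => sub u uT; have := sub u uT;
    have [uv evu] := Tl u uT; rewrite descents_mul_gen ?evu ?orbT // uv //.
have vf h : (v \in descents (f h)) = (v \notin descents h).
  by rewrite descents_mul_gen ?eqxx.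
have -> : (g \in [fset f x | x in X]%fset) = (f g \in X).
  by rewrite -{1}(fK g) mem_imfset.
rewrite in_fsetD !in_desc_sphere !finset.subUset !finset.sub1set subf vf /f len_mul_gen.
case: ifP => vd; case: (T \subset _); rewrite ?andbF ?andbT ?andNb //=.
have := card_descent (_ : descent e v (heap_of g)); rewrite -/(len g).
by move: vd; rewrite inE => -> /(_ isT); lia.
Qed.

Section Series.
Variable K : comNzRingType.

Definition desc_series T l : K := #|` desc_sphere T l|%:R.

Definition sphere_series l : K := (sphere_card S l)%:R.

Lemma desc_series0 l : desc_series finset.set0 l = sphere_series l.
Proof.
rewrite /desc_series /sphere_series /sphere_card; congr ((#|` _|)%:R).
by apply/fsetP => g; rewrite !inE /= finset.sub0set andbT.
Qed.

Lemma desc_series_setU1 (T : {set V}) v l : v \notin T -> clique e (v |: T) ->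
  conv (1 + 'X) (desc_series (v |: T)) l = conv 'X (desc_series T) l.
Proof.
move=> vT cl; rewrite convDl -polyC1 convC mul1r !convX.
case: l => [|l]; last by rewrite /desc_series (card_desc_sphere_setU1 l vT cl) natrD addrC.
rewrite addr0 /desc_series [desc_sphere _ _](_ : _ = fset0) ?cardfs0 //.
apply/fsetP => g; rewrite in_desc_sphere inE -descents_eq0.
apply/negbTE/negP => /andP [/eqP ->].
by rewrite finset.subset0 => /eqP /setP /(_ v); rewrite !inE eqxx.
Qed.

(** The series of the elements having all of [T] as descents is that of the
group times (t/(1+t))^|T|: iterate [desc_series_setU1] along [T]. *)
Lemma desc_series_conv (T : {set V}) l : clique e T ->
  conv ((1 + 'X) ^+ #|T|) (desc_series T) l = conv ('X ^+ #|T|) sphere_series l.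
Proof.
elim: {T}#|T| {-2}T (erefl #|T|) l => [|n IH] T cT l cl.
  move/eqP: cT; rewrite cards_eq0 => /eqP ->.
  by rewrite cards0 !expr0 -polyC1 !convC desc_series0.
have [v vT] : exists v, v \in T by apply/finset.set0Pn; rewrite -cards_eq0 cT.
move: cT cl; rewrite -(finset.setD1K vT); set T' := T :\ v.
have vT' : v \notin T' by rewrite !inE eqxx.
rewrite cardsU1 vT' add1n => -[cT'] cl.
have cl' : clique e T' by move: cl; rewrite clique_setU1 // => /andP [].
rewrite exprSr convM.
rewrite (@eq_conv _ _ _ (conv 'X (desc_series T'))); last first.
  by move=> i _; exact: desc_series_setU1.
rewrite -convM mulrC convM exprS convM.
by apply: eq_conv => i _; exact: IH.
Qed.

(** Exchanging the sums, an element contributes the alternating sum over the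
subsets of its descents, all of which are cliques.  Only the identity has no
descent. *)
Lemma alternating_desc_series l :
  \sum_(T : {set V} | clique e T) (-1) ^+ #|T| * desc_series T l
  = (l == 0%N)%:R :> K.
Proof.
have desc_seriesE T : desc_series T l =
    \sum_(g <- fset_set (sphere S l)) (T \subset descents g)%:R.
  rewrite /desc_series card_fset_sum1 natr_sum /desc_sphere.
  rewrite -big_fset_condE big_mkcond /=.
  by apply: eq_bigr => g _; case: ifP.
under eq_bigr => T _ do rewrite desc_seriesE mulr_sumr.
rewrite exchange_big /=.
transitivity (\sum_(g <- fset_set (sphere S l)) (len g == 0%N)%:R : K).
  apply: eq_bigr => g _; rewrite -descents_eq0.
  rewrite -(clique_sum1 e_sym K (clique_descents g)) /clique_sum.
  rewrite big_mkcond [RHS]big_mkcond; apply: eq_bigr => T _.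
  by case: (clique e T); case: (T \subset _); rewrite ?mulr1 ?mulr0.
rewrite big_seq (eq_bigr (fun g => (l == 0%N)%:R)); last first.
  by move=> g; rewrite in_sphere => /eqP ->.
rewrite -big_seq; case: l {desc_seriesE} => [|l]; last by rewrite big1.
rewrite [fset_set _](_ : _ = [fset 1%g])%fset ?big_seq_fset1 //.
apply/fsetP => g; rewrite in_sphere inE.
apply/eqP/eqP => [lg|->]; last by rewrite /len heap_of1 // cardfs0.
have [s Es sz] := reduced_word e_sym e_irr g; rewrite lg in sz.
by rewrite -Es (size0nil sz) /eval_word big_nil.
Qed.

(** Replacing each series in [alternating_desc_series] by [desc_series_conv], after
multiplication by (1+t)^|V|. *)
Lemma growth_series l :
  conv (clique_form e [set: V] 'X (1 + 'X)) sphere_series l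
  = ((1 + 'X) ^+ #|V| : {poly K})`_l.
Proof.
rewrite -conv_delta.
have E i : (i <= l)%N -> (i == 0%N)%:R = \sum_(T : {set V} | clique e T)
    conv ((-1) ^+ #|T|)%:P (desc_series T) i :> K.
  by rewrite -alternating_desc_series => _; apply: eq_bigr => T _; rewrite convC.
rewrite [RHS](eq_conv _ E) conv_sumr /clique_form conv_suml.
apply: eq_big => T; first by rewrite finset.subsetT.
move=> /andP [_ cl]; rewrite cardsT.
have TV : (#|T| <= #|V|)%N by rewrite max_card.
set c := (_%:P).
transitivity (conv (c * (1 + 'X) ^+ (#|V| - #|T|)) (conv ('X ^+ #|T|) sphere_series) l).
  by rewrite -convM exprNn -polyCN -polyC_exp -/c mulrAC.
rewrite -(@eq_conv _ _ _ _ l (fun i _ => desc_series_conv i cl)) -!convM.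
by rewrite -mulrA -exprD subnK // mulrC.
Qed.

End Series.
End Counting.

(** * Growth of a sequence and roots of its denominator *)

Lemma conv_XsubC (K : comNzRingType) (z : K) a l :
  conv ('X - z%:P) a l = (if l is l'.+1 then a l' else 0) - z * a l.
Proof. by rewrite -polyCN convDl convC convX mulNr. Qed.

Lemma conv_growth (F : numFieldType) (p : {poly F}) (a : nat -> F) (K mu : F) :
  0 < mu -> (forall l, `|a l| <= K * mu ^+ l) ->
  exists K', forall l, `|conv p a l| <= K' * mu ^+ l.
Proof.
move=> mu0; elim/poly_ind: p a K => [|p c IH] a K bd.
  by exists 0 => l; rewrite conv0 normr0 mul0r.
have K0 : 0 <= K.
  by have := bd 0%N; rewrite expr0 mulr1 => /(le_trans (normr_ge0 _)).
have [K' bd'] : exists K', forall l, `|conv p (conv 'X a) l| <= K' * mu ^+ l.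
  apply: (IH _ (K / mu)) => l; rewrite convX.
  case: l => [|l]; first by rewrite normr0 expr0 mulr1 divr_ge0 // ltW.
  by rewrite exprS mulrA divfK ?gt_eqF.
exists (K' + `|c| * K) => l; rewrite convDl convM convC mulrDl.
apply: le_trans (ler_normD _ _) _; rewrite normrM -mulrA.
by rewrite lerD // ler_wpM2l.
Qed.

Section UpperBound.
Variables (C : numClosedFieldType) (rho mu : C).
Hypotheses (rho_gt0 : 0 < rho) (mu_gt : rho^-1 < mu).

Let mu_gt0 : 0 < mu.
Proof. by apply: lt_trans mu_gt; rewrite invr_gt0. Qed.

(** Dividing by t - z amounts to solving z b_(l+1) = b_l - c_(l+1).  As
1/|z| <= 1/rho < mu, the exponential bound survives, with a constant that is
the fixed point of the estimate. *)
Lemma conv_XsubC_bound z (b : nat -> C) K :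
  rho <= `|z| -> (forall l, `|conv ('X - z%:P) b l| <= K * mu ^+ l) ->
  exists K', forall l, `|b l| <= K' * mu ^+ l.
Proof.
move=> rz bd; pose d := rho - mu^-1.
have d_gt0 : 0 < d.
  by rewrite subr_gt0 -[rho]invrK ltf_pV2 ?posrE ?invr_gt0.
have K_ge0 : 0 <= K.
  by have := bd 0%N; rewrite expr0 mulr1 => /(le_trans (normr_ge0 _)).
have z_gt0 : 0 < `|z| := lt_le_trans rho_gt0 rz.
exists (K / d); elim=> [|l IH].
  have := bd 0%N; rewrite conv_XsubC sub0r normrN normrM !expr0 !mulr1 => h.
  rewrite ler_pdivlMr // mulrC; apply: le_trans h; apply: ler_wpM2r => //.
  by apply: le_trans rz; rewrite gerBl invr_ge0 ltW.
have := bd l.+1; rewrite conv_XsubC => h.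
have : `|z * b l.+1| <= K * mu ^+ l.+1 + K / d * mu ^+ l.
  rewrite -[z * _](subKr (b l)) [leRHS]addrC.
  by rewrite (le_trans (ler_normB _ _)) // lerD.
have -> : K * mu ^+ l.+1 + K / d * mu ^+ l = rho * (K / d * mu ^+ l.+1).
  have dn : d != 0 by rewrite gt_eqF.
  have mun : mu != 0 by rewrite gt_eqF.
  have -> : rho = d + mu^-1 by rewrite subrK.
  by rewrite exprS; field; rewrite mun dn.
rewrite normrM => h2.
rewrite -(ler_pM2l rho_gt0); apply: le_trans h2.
by apply: ler_wpM2r.
Qed.

(** Split [p] into linear factors and divide by them successively. *)
Lemma conv_bound (p : {poly C}) (a : nat -> C) K :
  p != 0 -> (forall z, root p z -> rho <= `|z|) ->
  (forall l, `|conv p a l| <= K * mu ^+ l) ->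
  exists K', forall l, `|a l| <= K' * mu ^+ l.
Proof.
move=> p0 rp bd; have [r Dp] := closed_field_poly_normal p.
have c0 : lead_coef p != 0 by rewrite lead_coef_eq0.
have {}rp : all (fun z => rho <= `|z|) r.
  apply/allP => z zr; apply: rp; rewrite Dp rootZ // root_prod_XsubC //.
have {bd} : exists K', forall l,
    `|conv (\prod_(z <- r) ('X - z%:P)) a l| <= K' * mu ^+ l.
  exists (K / `|lead_coef p|) => l; rewrite mulrAC ler_pdivlMr ?normr_gt0 //.
  by have := bd l; rewrite {1}Dp -mul_polyC convM convC normrM mulrC.
elim: r rp {Dp} => [_|z r IH /= /andP [rz /IH {}IH]] [K' bd].
  by exists K' => l; have := bd l; rewrite big_nil -polyC1 convC mul1r.
apply: IH; apply: (conv_XsubC_bound rz (K := K')) => l.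
by have := bd l; rewrite big_cons convM.
Qed.

End UpperBound.

Section LowerBound.
Variable R : realFieldType.

(** Dividing [p] by t - rho leaves b = q a with b_l = rho b_(l+1) + c_(l+1) and
c >= 0, so that -b_l, which starts at 1/rho, is multiplied by at least 1/rho at
each step. *)
Lemma conv_root_lower (p : {poly R}) (a : nat -> R) (rho : R) : 0 < rho ->
  root p rho -> conv p a 0 = 1 -> (forall l, 0 <= conv p a l) ->
  exists q, forall l, rho^-1 ^+ l.+1 <= `|conv q a l|.
Proof.
move=> rho0 /factor_theorem [q Dq] c0 c_ge0; exists q => l.
rewrite Dq mulrC in c0 c_ge0.
suff : rho^-1 ^+ l.+1 <= - conv q a l.
  by move=> /le_trans; apply; rewrite -normrN ler_norm.
elim: l => [|l IH].
  move: c0; rewrite convM conv_XsubC sub0r expr1 => h.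
  by rewrite -[_^-1]mulr1 -h -mulrN mulKf // gt_eqF.
have := c_ge0 l.+1; rewrite convM conv_XsubC subr_ge0 => h.
rewrite exprS ler_pdivrMl // mulrN; by apply: le_trans IH _; rewrite lerN2.
Qed.

End LowerBound.

Section GrowthRate.
Variable R : realType.
Implicit Types (a : nat -> R) (x mu alpha : R).

Lemma bernoulli_inequality x n : 0 <= x -> 1 + n%:R * x <= (1 + x) ^+ n.
Proof.
move=> x0; elim: n => [|n IH]; first by rewrite mul0r addr0.
rewrite exprS; have n0 : (0 : R) <= n%:R by rewrite ler0n.
have := ler_wpM2l (addr_ge0 ler01 x0) IH; rewrite -natr1; apply: le_trans.
have : 0 <= n%:R * x * x by rewrite !mulr_ge0.
lra.
Qed.

Lemma expr_unbounded x M : 1 < x -> exists N, forall n, (N <= n)%N -> M <= x ^+ n.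
Proof.
move=> x1; have d0 : 0 < x - 1 by rewrite subr_gt0.
exists (Num.bound `|M / (x - 1)|) => n Nn.
have b : M / (x - 1) <= n%:R.
  apply: le_trans (ler_norm _) _; apply: ltW.
  by apply: lt_le_trans (archi_boundP (normr_ge0 _)) _; rewrite ler_nat.
have := bernoulli_inequality n (ltW d0).
rewrite [1 + (x - 1)]addrC subrK; apply: le_trans.
by move: b; rewrite ler_pdivrMr // => /le_trans; apply; lra.
Qed.

Definition exp_growth a : \bar R :=
  limn_esup (fun l : nat => (a l `^ (l%:R^-1))%:E).

Lemma root_le a mu l : 0 < mu -> 0 <= a l -> (0 < l)%N -> a l <= mu ^+ l ->
  a l `^ l%:R^-1 <= mu.
Proof.
move=> mu0 a0 l0 h.
have -> : mu = (mu ^+ l) `^ l%:R^-1.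
  rewrite -powR_mulrn ?ltW // -powRrM mulfV ?powRr1 ?ltW //.
  by rewrite pnatr_eq0 -lt0n.
by rewrite ge0_ler_powR ?invr_ge0 // nnegrE exprn_ge0 // ltW.
Qed.

Lemma root_gt a mu l : 0 < mu -> 0 <= a l -> (0 < l)%N -> mu ^+ l < a l ->
  mu < a l `^ l%:R^-1.
Proof.
move=> mu0 a0 l0; apply: contraTT; rewrite -!leNgt => h.
have -> : a l = (a l `^ l%:R^-1) ^+ l.
  rewrite -powR_mulrn ?powR_ge0 // -powRrM mulVf ?powRr1 //.
  by rewrite pnatr_eq0 -lt0n.
by rewrite lerXn2r // nnegrE ?powR_ge0 // ltW.
Qed.

Lemma exp_growth_le a alpha : 0 < alpha -> (forall l, 0 <= a l) ->
  (forall mu, alpha < mu -> exists K, forall l, a l <= K * mu ^+ l) ->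
  (exp_growth a <= alpha%:E)%E.
Proof.
move=> al0 a0 bd; apply/lee_addgt0Pr => eps eps0; rewrite -EFinD.
have [K Kbd] := bd (alpha + eps / 2) ltac:(lra).
set mu := alpha + eps / 2 in Kbd; pose mu' := alpha + eps.
have mu0 : 0 < mu by rewrite /mu; lra.
have mu'0 : 0 < mu' by rewrite /mu'; lra.
have [|N HN] := @expr_unbounded (mu' / mu) K.
  by rewrite ltr_pdivlMr // mul1r /mu /mu'; lra.
apply: ge_ereal_inf.
exists (ereal_sup ((fun l => (a l `^ l%:R^-1)%:E) @` [set l | (N.+1 <= l)%N]))%classic.
  by exists [set l | (N.+1 <= l)%N]%classic => //; exists N.+1.
apply: ge_ereal_sup => _ [l Nl <-]; rewrite lee_fin.
apply: root_le => //; first exact: leq_trans Nl.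
apply: le_trans (Kbd l) _; rewrite -ler_pdivlMr ?exprn_gt0 // -expr_div_n.
by apply: HN; rewrite ltnW.
Qed.

(** The constant [K] lets the failure of the bound be pushed beyond any given
index: choosing it larger than all a_n / mu^n with n <= N excludes the
indices up to [N]. *)
Lemma exp_growth_ge a alpha : 0 < alpha -> (forall l, 0 <= a l) ->
  (forall mu, 0 < mu < alpha -> forall K, exists l, K * mu ^+ l < a l) ->
  (alpha%:E <= exp_growth a)%E.
Proof.
move=> al0 a0 bd; apply: le_ereal_inf_tmp => _ [A [N _ NA] <-].
apply/lee_subgt0Pr => eps eps0; rewrite -EFinB.
pose mu := Num.max (alpha - eps) (alpha / 2).
have mu0 : 0 < mu by rewrite lt_max; apply/orP; right; lra.
have mua : mu < alpha by rewrite gt_max; apply/andP; split; lra.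
pose F n := a n / mu ^+ n.
have F0 n : 0 <= F n by rewrite divr_ge0 // exprn_ge0 // ltW.
have [|l] := bd mu _ (1 + \sum_(n < N.+1) F n); first by rewrite mu0.
have [lN|Nl] := ltnP l N.+1.
  rewrite ltNge (_ : _ <= _) // -ler_pdivrMr ?exprn_gt0 // -/(F l).
  by rewrite (bigD1 (Ordinal lN)) //= addrCA lerDl addr_ge0 // sumr_ge0.
move=> h; apply: (@le_trans _ _ (a l `^ l%:R^-1)%:E); last first.
  by apply: ereal_sup_ubound; exists l => //; apply: NA; exact: ltnW.
rewrite lee_fin; apply: (@le_trans _ _ mu); first by rewrite le_max lexx.
apply/ltW/root_gt => //; first exact: leq_trans Nl.
apply: le_lt_trans h; rewrite -[leLHS]mul1r; apply: ler_wpM2r.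
  by rewrite exprn_ge0 // ltW.
by rewrite lerDl sumr_ge0.
Qed.

End GrowthRate.

(** * Domination *)

Section Domination.
Variable K : numFieldType.
Implicit Types (p q c : (K * K)%type).

(** The pair of values at z and at r >= |z| of a power series with nonnegative
coefficients is dominated. *)
Definition dominated p : bool := `|p.1| <= p.2.

Lemma dominated1 : dominated 1.
Proof. by rewrite /dominated normr1. Qed.

Lemma dominatedD p q : dominated p -> dominated q -> dominated (p + q).
Proof. by move=> hp hq; rewrite /dominated (le_trans (ler_normD _ _)) // lerD. Qed.

Lemma dominatedM p q : dominated p -> dominated q -> dominated (p * q).
Proof. by move=> hp hq; rewrite /dominated normrM ler_pM. Qed.

Lemma dominated_geometric c : dominated c -> c.2 < 1 ->
  exists2 g, dominated g & g * (1 - c) = 1.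
Proof.
move=> dc c1; have d2 : 0 < 1 - c.2 by rewrite subr_gt0.
have d1 : 1 - c.2 <= `|1 - c.1|.
  have := lerB_dist (1 : K) c.1; rewrite normr1; apply: le_trans.
  by rewrite lerD2l lerN2.
have n1 : 0 < `|1 - c.1| := lt_le_trans d2 d1.
exists ((1 - c.1)^-1, (1 - c.2)^-1).
  by rewrite /dominated /= normfV lef_pV2.
have n1' : 1 - c.1 != 0 by rewrite -normr_gt0.
by congr pair; [exact: mulVf n1' | apply: mulVf; rewrite gt_eqF].
Qed.

Variables (V : finType) (e : rel V).
Hypothesis e_sym : symmetric e.
Variables (z r : K).
Hypotheses (zr : `|z| <= r) (r_lt1 : r < 1).

Let tau : (K * K)%type := (z, r).
Let xi : (K * K)%type := (z / (1 + z), r / (1 + r)).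
Local Notation q A := (clique_sum e A xi).

Let r_ge0 : 0 <= r. Proof. exact: le_trans zr. Qed.

Let dominated_tau : dominated tau. Proof. exact: zr. Qed.

Let xiE : xi * (1 + tau) = tau.
Proof.
rewrite [LHS](_ : _ = (z / (1 + z) * (1 + z), r / (1 + r) * (1 + r))) //.
rewrite !divfK //; first by rewrite gt_eqF // ltr_wpDr.
rewrite addrC addr_eq0; apply/eqP => z1; move: zr.
by rewrite z1 normrN normr1 => /le_lt_trans /(_ r_lt1); rewrite ltxx.
Qed.

(** The recursion [clique_sum_del] at x = t/(1+t), multiplied by 1+t: if
q_L/q_(A-v) is 1 + c, then q_A/q_(A-v) is (1 - t c)/(1+t). *)
Lemma delete_vertex (A : {set V}) v c : v \in A ->
  q ((A :\ v) :&: link e v) = q (A :\ v) * (1 + c) ->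
  q (A :\ v) * (1 - tau * c) = q A * (1 + tau).
Proof.
move=> vA E; rewrite (clique_sum_del e_sym _ vA) E.
set a := q _; have := xiE; set x := xi; set t := tau => xt.
have -> : (a - x * (a * (1 + c))) * (1 + t) =
    a * (1 + t) - a * (1 + c) * (x * (1 + t)) by ring.
by rewrite xt; ring.
Qed.

Let q_snd A : (q A).2 = clique_sum e A (r / (1 + r)).
Proof. exact: (rmorph_clique_sum e snd). Qed.

Definition positive_below (A : {set V}) : Prop :=
  forall B : {set V}, B \subset A -> 0 < clique_sum e B (r / (1 + r)).

(** Positivity of q_A and q_(A-v) at r says exactly that the second component of
[tau * c] is less than 1, so that the geometric series [g] exists.  The fixed
point equation of [g] is kept, since it shows the first terms of the
expansion. *)
Lemma delete_vertex_ratio (A : {set V}) v c :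
  positive_below A -> v \in A -> dominated c ->
  q ((A :\ v) :&: link e v) = q (A :\ v) * (1 + c) ->
  exists g, [/\ dominated g, g = 1 + tau * c * g &
    q (A :\ v) = q A * ((1 + tau) * g)].
Proof.
move=> pA vA dc E; have D := delete_vertex vA E.
have pA1 : 0 < (q A).2 by rewrite q_snd pA.
have pv : 0 < (q (A :\ v)).2 by rewrite q_snd pA // finset.subsetDl.
have small : (tau * c).2 < 1.
  have : 0 < (q A * (1 + tau)).2 by rewrite mulr_gt0 // ltr_wpDr.
  rewrite -D [X in 0 < X](_ : _ = (q (A :\ v)).2 * (1 - (tau * c).2)) //.
  by rewrite pmulr_rgt0 // subr_gt0.
have [g dg gE] := dominated_geometric (dominatedM dominated_tau dc) small.
exists g; split => //; last first.
  by rewrite mulrA -D -mulrA [X in _ * X]mulrC gE mulr1.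
by rewrite -{1}gE; ring.
Qed.

Ltac dominate := repeat first
  [ assumption | exact: dominated1 | exact: dominated_tau | apply: dominatedD
  | apply: dominatedM ].

(** Remove the vertices of A outside B one at a time.  The induction is on the
size of A because [delete_vertex_ratio] needs the result for the link of v in
A - v. *)
Lemma dominated_ratio (A B : {set V}) : positive_below A -> B \subset A ->
  exists2 c, dominated c & q B = q A * (1 + c).
Proof.
elim: {A}#|A| {-2}A (leqnn #|A|) B => [|n IH] A cA B pA BA.
  exists 0; first by rewrite /dominated normr0.
  rewrite addr0 mulr1; congr (q _).
  by apply/eqP; rewrite eqEcard BA (leq_trans cA).
have [AB|] := boolP (A \subset B).
  exists 0; first by rewrite /dominated normr0.
  by rewrite addr0 mulr1; congr (q _); apply/eqP; rewrite finset.eqEsubset BA AB.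
move=> /subsetPn [v vA vB].
have cAv : (#|A :\ v| <= n)%N by move: cA; rewrite (cardsD1 v A) vA.
have pv : positive_below (A :\ v).
  by move=> C CA; apply: pA; apply: fintype.subset_trans CA (finset.subsetDl _ _).
have [c dc Ec] := IH _ cAv _ pv (finset.subsetIl _ (link e v)).
have [g [dg gE Ev]] := delete_vertex_ratio pA vA dc Ec.
have [|c' dc' ->] := IH _ cAv B pv; first by rewrite finset.subsetD1 BA.
exists (tau + tau * c * g + tau * (tau * c * g) + c' * ((1 + tau) * g)).
  by dominate.
have -> : q (A :\ v) * (1 + c') = q A * ((1 + tau) * g + (1 + tau) * g * c').
  by rewrite Ev; ring.
by rewrite {1}gE; ring.
Qed.

(** The first terms of the expansion: the factor obtained by removing [u] first
is (1+t) g with g in 1 + (dominated pairs). *)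
Lemma dominated_ratio1 (A B : {set V}) u : positive_below A -> B \subset A ->
  u \in A -> u \notin B ->
  exists2 c, dominated c & q B = q A * (1 + tau + c).
Proof.
move=> pA BA uA uB.
have pv : positive_below (A :\ u).
  by move=> C CA; apply: pA; apply: fintype.subset_trans CA (finset.subsetDl _ _).
have [c dc Ec] := dominated_ratio pv (finset.subsetIl _ (link e u)).
have [g [dg gE Ev]] := delete_vertex_ratio pA uA dc Ec.
have [|c' dc' ->] := dominated_ratio (B := B) pv; first by rewrite finset.subsetD1 BA.
exists (tau * c * g + tau * (tau * c * g) + c' * ((1 + tau) * g)).
  by dominate.
have -> : q (A :\ u) * (1 + c') = q A * ((1 + tau) * g + (1 + tau) * g * c').
  by rewrite Ev; ring.
by rewrite {1}gE; ring.
Qed.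

(** The term t^2 counts an element u w or w u of length 2 of the group on [A]
that has no descent in [B].  If [w] is outside [B], it comes from the product
of the factors 1+t of [u] and [w]; if [w] does not commute with [u], it comes
from the geometric series attached to [u]. *)
Lemma dominated_ratio2 (A B : {set V}) u w : positive_below A -> B \subset A ->
  u \in A -> u \notin B -> w \in A :\ u ->
  (w \notin B) || (w \notin link e u) ->
  exists2 c, dominated c & q B = q A * (1 + tau + tau ^+ 2 + c).
Proof.
move=> pA BA uA uB wA wBu.
have pv : positive_below (A :\ u).
  by move=> C CA; apply: pA; apply: fintype.subset_trans CA (finset.subsetDl _ _).
have BAu : B \subset A :\ u by rewrite finset.subsetD1 BA.
have [wB|wB] := boolP (w \notin B).
  have [|c dc Ec] := dominated_ratio1 pA (finset.subsetDl A [set u]) uA.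
    by rewrite !inE eqxx.
  have [c' dc' ->] := dominated_ratio1 pv BAu wA wB.
  exists (tau + c * (1 + tau + c') + (1 + tau) * c'); first by dominate.
  by rewrite Ec; ring.
have {wBu} wl : w \notin link e u by move: wBu; rewrite (negPf wB).
have [|c dc Ec] := dominated_ratio1 pv (finset.subsetIl _ (link e u)) wA.
  by rewrite inE (negPf wl) andbF.
rewrite -addrA in Ec.
have dc1 : dominated (tau + c) by dominate.
have [g [dg gE Ev]] := delete_vertex_ratio pA uA dc1 Ec.
have [c' dc' ->] := dominated_ratio pv BAu.
set h := tau * (tau + c) * g in gE; have dh : dominated h by dominate.
exists (tau * c + tau * (tau + c) * h + tau * (tau * (tau + c) * (1 + h))
        + c' * ((1 + tau) * g)).
  by dominate.
have E : g = 1 + tau * (tau + c) * (1 + h) by rewrite {1}gE /h -gE.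
have -> : q (A :\ u) * (1 + c') = q A * ((1 + tau) * g + (1 + tau) * g * c').
  by rewrite Ev; ring.
by rewrite {1}E; ring.
Qed.

End Domination.

(** * The zero of least modulus *)

Section UniqueZero.
Variables (C : numClosedFieldType) (V : finType) (e : rel V).
Hypothesis e_sym : symmetric e.

Lemma add1_norm_eq (z r : C) : `|z| <= r -> 1 + r <= `|1 + z| -> z = r.
Proof.
move=> zr h.
have D : `|1 + z| = `|1| + `|z|.
  apply/eqP; rewrite eq_le ler_normD /=; apply: le_trans h.
  by rewrite normr1 lerD2l.
have [t _ [t1 zt]] := normCDeq D; rewrite normr1 mul1r in t1.
rewrite -t1 mulr1 in zt; rewrite zt; apply/eqP; rewrite eq_le zr /=.
by rewrite -(lerD2l 1) -[X in _ <= X + _]normr1 -D.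
Qed.

(** Both z and r are solutions of F = 1, where F = t (q_L/q_(A-v) - 1) and
F - t^2 - t^3 is dominated.  Hence
r^2 + r^3 = 1 - (F - t^2 - t^3)(r) <= |z^2 + z^3| <= r^2 |1 + z|.  The
existence of the vertices u and w producing t^2 and t^3 uses that q_A vanishes
at r whereas q_B does not for smaller sets: if v commutes with all other
vertices then q_A = (1 - x) q_(A-v), and if the only obstruction is a pair u, v
commuting with all other vertices then q_A = (1 - 2x) q_L; neither factor
vanishes for x = r/(1+r) with r < 1. *)
Lemma unique_zero (A : {set V}) (z r : C) :
  `|z| <= r -> 0 < r -> r < 1 ->
  (forall B : {set V}, B \proper A -> 0 < clique_sum e B (r / (1 + r))) ->
  clique_sum e A (r / (1 + r)) = 0 -> clique_sum e A (z / (1 + z)) = 0 ->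
  z = r.
Proof.
move=> zr r0 r1 pB Ar Az.
pose tau : (C * C)%type := (z, r).
pose xi : (C * C)%type := (z / (1 + z), r / (1 + r)).
pose q B := clique_sum e B xi.
have q1 B : (q B).1 = clique_sum e B (z / (1 + z)) by exact: (rmorph_clique_sum e fst).
have q2 B : (q B).2 = clique_sum e B (r / (1 + r)) by exact: (rmorph_clique_sum e snd).
have qA : q A = 0 by rewrite [q A]surjective_pairing q1 q2 Ar Az.
have pos (B : {set V}) : B \proper A -> 0 < (q B).2 by rewrite q2; exact: pB.
have r1_gt0 : 0 < 1 + r by rewrite ltr_wpDr // ltW.
have [v vA] : exists v, v \in A.
  apply/finset.set0Pn; apply: contra_eq_neq Ar => ->.
  by rewrite clique_sum0 oner_neq0.
pose A' := A :\ v; pose L := A' :&: link e v.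
have A'A : A' \proper A by exact: properD1.
have LA' : L \subset A' by exact: finset.subsetIl.
have LA : L \proper A := sub_proper_trans LA' A'A.
have posA' : positive_below e r A'.
  by move=> B BA'; apply: pB; exact: sub_proper_trans BA' A'A.
have qA' : q A = q A' - xi * q L by exact: clique_sum_del.
have [u uA' uL] : exists2 u, u \in A' & u \notin L.
  apply/subsetPn; apply/negP => A'L.
  have EL : L = A' by apply/eqP; rewrite finset.eqEsubset LA' A'L.
  have : (q A' * (1 - xi)).2 = 0 by rewrite mulrBr mulr1 mulrC -{2}EL -qA' qA.
  apply/eqP; rewrite gt_eqF // mulr_gt0 ?pos // subr_gt0.
  by rewrite /= ltr_pdivrMr // mul1r ltrDr.
have [w wA' wLu] : exists2 w, w \in A' :\ u & (w \notin L) || (w \notin link e u).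
  have [/exists_inP [w w1 w2]|no] :=
    boolP [exists w in A' :\ u, (w \notin L) || (w \notin link e u)].
    by exists w.
  exfalso; have {}no w : w \in A' :\ u -> (w \in L) && (w \in link e u).
    move=> wA'; apply: contraNT no => h; apply/exists_inP; exists w => //.
    by rewrite -negb_and.
  have EL : L = A' :\ u.
    apply/eqP; rewrite finset.eqEsubset finset.subsetD1 LA' uL /=.
    by apply/fintype.subsetP => w /no /andP [].
  have EL' : (A' :\ u) :&: link e u = L.
    rewrite EL; apply/finset.setIidPl/fintype.subsetP => w /no.
    by case/andP.
  have E' : q A' = q (A' :\ u) - xi * q ((A' :\ u) :&: link e u).
    exact: clique_sum_del.
  have : (q L * (1 - xi - xi)).2 = 0.
    suff <- : q A = q L * (1 - xi - xi) by rewrite qA.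
    by rewrite qA' E' EL' -EL; ring.
  apply/eqP; rewrite gt_eqF // mulr_gt0 ?pos //.
  rewrite (_ : _.2 = 1 - r / (1 + r) - r / (1 + r)) // -addrA -opprD -mulrDl subr_gt0.
  by rewrite ltr_pdivrMr // mul1r ltrD2r.
(* As q_A = 0 and q_(A-v) is invertible, [delete_vertex] becomes F = 1. *)
have [c dc Ec] := dominated_ratio2 e_sym zr r1 posA' LA' uA' uL wA' wLu.
have := delete_vertex e_sym zr r1 (c := tau + tau ^+ 2 + c) vA.
rewrite -/A' -/L -/xi -/tau -/(q A') -/(q L) -/(q A) qA mul0r => D.
have {}D : q A' * (1 - tau * (tau + tau ^+ 2 + c)) = 0.
  by apply: D; rewrite [LHS]Ec !addrA.
have qA'2 : (q A').2 != 0 by rewrite gt_eqF // pos.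
have qA'1 : (q A').1 != 0.
  have [|c' _ E'] := dominated_ratio e_sym zr r1 posA' (B := finset.set0).
    exact: finset.sub0set.
  have : (q A').1 * (1 + c').1 = 1.
    by rewrite clique_sum0 in E'; exact: (esym (congr1 fst E')).
  by apply: contra_eq_neq => ->; rewrite mul0r eq_sym oner_neq0.
have F1 : 1 - z * (z + z ^+ 2 + c.1) = 0.
  by apply: (mulfI qA'1); rewrite mulr0; exact: (congr1 fst D).
have F2 : 1 - r * (r + r ^+ 2 + c.2) = 0.
  by apply: (mulfI qA'2); rewrite mulr0; exact: (congr1 snd D).
apply: add1_norm_eq => //.
rewrite -(ler_pM2l (exprn_gt0 2 r0)).
apply: (@le_trans _ _ (`|z| ^+ 2 * `|1 + z|)); last first.
  by rewrite ler_wpM2r // lerXn2r // nnegrE ltW.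
rewrite -normrX -normrM.
have -> : z ^+ 2 * (1 + z) = 1 - z * c.1.
  apply/eqP; rewrite -subr_eq0.
  have -> : z ^+ 2 * (1 + z) - (1 - z * c.1) = - (1 - z * (z + z ^+ 2 + c.1)) by ring.
  by rewrite F1 oppr0.
have -> : r ^+ 2 * (1 + r) = 1 - r * c.2.
  apply/eqP; rewrite -subr_eq0.
  have -> : r ^+ 2 * (1 + r) - (1 - r * c.2) = - (1 - r * (r + r ^+ 2 + c.2)) by ring.
  by rewrite F2 oppr0.
have := lerB_dist 1 (z * c.1); rewrite normr1; apply: le_trans.
by rewrite lerD2l lerN2 normrM ler_pM.
Qed.

End UniqueZero.

(** * Roots of polynomials *)

Section LeastRoot.
Variables (R : rcfType) (I : finType) (p : I -> {poly R}).
Hypothesis p0 : forall i, 0 < (p i).[0].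

Lemma pos_before_root i t : 0 < t ->
  (forall s, 0 < s < t -> ~~ root (p i) s) -> 0 <= (p i).[t].
Proof.
move=> t0 nr; rewrite leNgt; apply/negP => neg.
have [|s /andP [s0 st] rs] := @poly_ivt _ (- p i) 0 t (ltW t0).
  by rewrite !hornerN oppr_le0 oppr_ge0 !ltW.
rewrite rootN in rs.
have s_neq0 : s != 0 by apply: contraTneq rs => ->; rewrite /root gt_eqF.
have s_neqt : s != t by apply: contraTneq rs => ->; rewrite /root lt_eqF.
by move: rs; apply/negP/nr; rewrite !lt_neqAle eq_sym s_neq0 s0 s_neqt st.
Qed.

Lemma least_root :
  (forall i t, 0 <= t < 1 -> 0 < (p i).[t]) \/
  exists2 rho, 0 < rho < 1 &
    [/\ forall i t, 0 <= t < rho -> 0 < (p i).[t],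
        forall i, 0 <= (p i).[rho] & exists i, root (p i) rho].
Proof.
have pos b : (forall i t, 0 < t < b -> ~~ root (p i) t) ->
    forall i t, 0 <= t < b -> 0 < (p i).[t].
  move=> nr i t /andP []; rewrite le_eqVlt => /predU1P [<- //|t0 tb].
  rewrite lt_neqAle eq_sym -/(root (p i) t) nr ?t0 //=.
  apply: pos_before_root => // s /andP [s0 st].
  by rewrite nr // s0 (lt_trans st).
pose P := \prod_i p i.
have P0 : P != 0.
  by apply/prodf_neq0 => i _; apply: contraTneq (p0 i) => ->; rewrite horner0 ltxx.
have rootP i t : root (p i) t -> root P t.
  by move=> rt; rewrite /P (bigD1 i) //= rootM rt.
case E : (roots P 0 1) => [|rho l].
  left; apply: pos => i t t01; apply/negP => /rootP rt.
  by have := in_roots P 0 1 t; rewrite E in_nil rt P0 in_itv /= t01.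
have : rho \in roots P 0 1 by rewrite E mem_head.
rewrite in_roots in_itv /= => /and3P [rrho rho01 _].
right; exists rho => //; have /andP [rho0 rho1] := rho01.
have nr i t : 0 < t < rho -> ~~ root (p i) t.
  move=> /andP [t0 trho]; apply/negP => /rootP rt.
  have : t \in roots P 0 1.
    by rewrite in_roots rt P0 in_itv /= t0 (lt_trans trho).
  rewrite E inE (lt_eqF trho) /= => ts.
  have := sorted_roots 0 1 P; rewrite E /= (path_sortedE lt_trans).
  by case/andP => /allP /(_ _ ts); rewrite (lt_gtF trho).
split; first exact: pos.
  by move=> i; apply: pos_before_root => // s; apply: nr.
have [i _ ri] : exists2 i, i \in index_enum I & root (p i) rho.
  apply/hasP; move: rrho; rewrite /P.
  elim: (index_enum I) => [|i r IH]; first by rewrite big_nil (negPf (root1 _)).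
  by rewrite big_cons rootM /= => /orP [->|/IH ->]; rewrite ?orbT.
by exists i.
Qed.

End LeastRoot.

(** The irreducible polynomial divides [q] over the rationals, since their gcd
has the root [x]. *)
Lemma irreducible_root_transfer (F : numFieldType) (p : {poly rat})
    (q : {poly int}) (x y : F) :
  irreducible_poly p -> root (map_poly ratr p) x -> root (map_poly intr q) x ->
  root (map_poly ratr p) y -> root (map_poly intr q) y.
Proof.
move=> [p1 irr] px qx py.
pose q' : {poly rat} := map_poly intr q.
have Eq : map_poly intr q = map_poly ratr q' :> {poly F}.
  by rewrite -map_poly_comp; apply: eq_map_poly => i /=; rewrite ratr_int.
rewrite Eq in qx *.
have : gcdp p q' %= p.
  apply: irr (dvdp_gcdl _ _); apply/negP => g1.
  have : root (map_poly (ratr : rat -> F) (gcdp p q')) x.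
    by rewrite gcdp_map root_gcd px.
  have /size_poly1P [c c0 ->] := g1.
  by rewrite map_polyC rootC fmorph_eq0 (negPf c0).
move=> /andP [_ pg]; have /dvdpP [s ->] := dvdp_trans pg (dvdp_gcdr _ _).
by rewrite rmorphM rootM py orbT.
Qed.

(** * The polynomials attached to a set of vertices *)

Section CliquePolynomials.
Variables (V : finType) (e : rel V).

(** (1+t)^|A| q_A(t/(1+t)). *)
Definition series_denom (K : comNzRingType) (A : {set V}) : {poly K} :=
  clique_form e A 'X (1 + 'X).

(** The reciprocal polynomial of [series_denom], that is the characteristic
polynomial of the linear recurrence satisfied by the sizes of the spheres in
the group generated by [A]. *)
Definition recurrence_poly (A : {set V}) : {poly int} :=
  clique_form e A 1 (1 + 'X).

Lemma clique_sum_at0 (K : comNzRingType) (A : {set V}) : clique_sum e A (0 : K) = 1.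
Proof.
rewrite /clique_sum (bigD1 finset.set0) ?finset.sub0set ?clique0 //=.
rewrite cards0 expr0 big1 ?addr0 // => C /andP [_ C0].
by rewrite oppr0 expr0n cards_eq0 (negPf C0).
Qed.

Lemma horner_series_denom (K : fieldType) (A : {set V}) (t : K) : 1 + t != 0 ->
  (series_denom K A).[t] = (1 + t) ^+ #|A| * clique_sum e A (t / (1 + t)).
Proof.
move=> t1; rewrite -clique_formE // -[LHS]/(horner_eval t _).
by rewrite rmorph_clique_form /horner_eval rmorphD /= /horner_eval hornerX hornerC.
Qed.

Lemma root_recurrence_poly (K : numFieldType) (A : {set V}) (y : K) : 1 + y != 0 ->
  root (map_poly intr (recurrence_poly A)) y = (clique_sum e A (1 + y)^-1 == 0).
Proof.
move=> y1; rewrite /root rmorph_clique_form rmorph1 rmorphD rmorph1 /= map_polyX.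
rewrite -[X in X == 0]/(horner_eval y _) rmorph_clique_form rmorphD rmorph1.
rewrite /= /horner_eval hornerX clique_formE // mulf_eq0 div1r.
by rewrite expf_eq0 (negPf y1) andbF.
Qed.

Lemma recurrence_poly_monic A : recurrence_poly A \is monic.
Proof.
rewrite monicE /recurrence_poly /clique_form (bigD1 finset.set0) /=; last first.
  by rewrite finset.sub0set clique0.
have sz n : size ((1 + 'X) ^+ n : {poly int}) = n.+1.
  by rewrite addrC -polyC1 -[1%:P]opprK -polyCN size_exp_XsubC.
rewrite cards0 expr0 mul1r subn0 lead_coefDl.
  rewrite addrC -polyC1; apply/eqP/monicP; exact/monic_exp/monicXaddC.
rewrite sz ltnS; apply: leq_trans (size_sum _ _ _) _.
apply/bigmax_leqP => C /andP [/andP [CA _] C0].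
rewrite size_Msign sz ltn_subrL card_gt0 C0 /= card_gt0.
by apply: contraNneq C0 => A0; rewrite A0 finset.subset0 in CA.
Qed.

End CliquePolynomials.

(** * Growth rate and Perron numbers *)

Section Growth.
Variables (R : realType) (V : finType) (e : rel V).
Hypotheses (e_sym : symmetric e) (e_irr : irreflexive e).
Local Notation S := (racg_gens e).
Local Notation a := (sphere_series e R).
Local Notation toC := (real_complex R).
Local Notation full := (finset.setTfor V).

Lemma real_complex_ge0 (x : R[i]) : 0 <= x -> x = toC (complex.Re x).
Proof. by move=> x0; rewrite RRe_real // ger0_real. Qed.

Lemma clique_sum_toC (A : {set V}) (t : R) :
  clique_sum e A (toC t / (1 + toC t)) = toC (clique_sum e A (t / (1 + t))).
Proof. by rewrite rmorph_clique_sum fmorph_div rmorphD rmorph1. Qed.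

Lemma sphere_growth_le (rho : R) : 0 < rho <= 1 ->
  (forall z : R[i], root (series_denom e _ full) z -> toC rho <= `|z|) ->
  (exp_growth a <= (rho^-1)%:E)%E.
Proof.
move=> /andP [rho0 rho1] rts.
apply: exp_growth_le; rewrite ?invr_gt0 // => mu mu_gt.
have mu1 : 1 <= mu by apply: le_trans (ltW mu_gt); rewrite invf_ge1.
have mu0 : 0 < mu by apply: lt_le_trans mu1.
pose aC := sphere_series e R[i].
have [K Kbd] : exists K, forall l,
    `|conv (series_denom e _ full) aC l| <= K * toC mu ^+ l.
  have [||K Kbd] := @conv_growth _ ((1 + 'X) ^+ #|V|)
    (fun n => (n == 0%N)%:R : R[i]) 1 (toC mu).
  - by rewrite -(rmorph0 toC) ltcR.
  - move=> l; rewrite mul1r normr_nat -(rmorph_nat toC) -(rmorphXn toC) lecR.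
    by case: (l == 0%N); rewrite ?exprn_ege1 // exprn_ge0 // ltW.
  by exists K => l; have := Kbd l; rewrite conv_delta growth_series.
have rho0C : 0 < toC rho by rewrite -(rmorph0 toC) ltcR.
have mu_gtC : (toC rho)^-1 < toC mu by rewrite -fmorphV ltcR.
have P0 : series_denom e R[i] full != 0.
  apply/eqP => P0; have := horner_series_denom e full (t := 0 : R[i]).
  rewrite -/(series_denom e R[i] full) P0 horner0 addr0 mul0r expr1n mul1r clique_sum_at0.
  by move=> /(_ (oner_neq0 _)) /eqP; rewrite eq_sym oner_eq0.
have [K' K'bd] := conv_bound rho0C mu_gtC P0 rts Kbd.
have K'E : K' = toC (complex.Re K').
  apply: real_complex_ge0.
  by have := K'bd 0%N; rewrite expr0 mulr1 => /(le_trans (normr_ge0 _)).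
exists (complex.Re K') => l; rewrite -lecR rmorphM rmorphXn /= -K'E.
by have := K'bd l; rewrite /aC /sphere_series normr_nat rmorph_nat.
Qed.

Lemma sphere_growth_ge (rho : R) : 0 < rho ->
  root (series_denom e R full) rho -> ((rho^-1)%:E <= exp_growth a)%E.
Proof.
move=> rho0 rt; apply: exp_growth_ge; rewrite ?invr_gt0 // => mu /andP [mu0 mu_lt] K.
apply: contrapT => no.
have bd l : `|a l| <= K * mu ^+ l.
  by rewrite normr_nat leNgt; apply/negP => h; apply: no; exists l.
have [q qE] : exists q, forall l, rho^-1 ^+ l.+1 <= `|conv q a l|.
  apply: (conv_root_lower rho0 rt) => [|l]; rewrite growth_series //.
    by rewrite -horner_coef0 horner_exp hornerD hornerX hornerC addr0 expr1n.
  elim: #|V| l => [|n IH] l; first by rewrite expr0 coef1 ler0n.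
  rewrite exprS mulrDl mul1r coefD coefXM addr_ge0 //.
  by case: (l == 0%N).
have [K' K'bd] := conv_growth q mu0 bd.
have [|N HN] := @expr_unbounded _ (rho^-1 / mu) (K' * rho + 1).
  by rewrite ltr_pdivlMr // mul1r.
have := HN N (leqnn _); have := le_trans (qE N) (K'bd N).
rewrite exprS mulrC -ler_pdivlMr ?invr_gt0 // invrK => h1.
rewrite expr_div_n ler_pdivlMr ?exprn_gt0 // => h2.
have := le_trans h2 h1; rewrite mulrAC ler_pM2r ?exprn_gt0 //.
by rewrite leNgt ltrDl ltr01.
Qed.

(** Removing descents from a longer element produces an element of each smaller
length, so that an empty sphere bounds the length. *)
Lemma sphere_card_gt0 l : infinite_set [set: racg e] -> (0 < sphere_card S l)%N.
Proof.
move=> inf; rewrite lt0n; apply/eqP => /cardfs0_eq sl0; apply: inf.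
have small k (g : racg e) : len g <> (l + k)%N.
  elim: k g => [|k IH] g lg.
    by have := in_sphere e_sym e_irr l g; rewrite sl0 inE lg addn0 eqxx.
  have /set0Pn [v vD] : descents g != finset.set0.
    by rewrite (descents_eq0 e_sym e_irr) lg addnS.
  by apply: (IH (g * pres_gen _ v)%g); rewrite len_mul_gen // vD lg addnS.
apply: (@sub_finite_set _ _ (\bigcup_(k < l) sphere S k)%classic).
  move=> g _; exists (len g); last exact/(has_word_lengthP e_sym e_irr).
  by rewrite /= ltnNge; apply/negP => h; apply: (small (len g - l)%N g); rewrite subnKC.
by apply: bigcup_finite => // k _; exact: finite_sphere.
Qed.

Lemma sphere_growth_ge1 : infinite_set [set: racg e] -> (1 <= exp_growth a)%E.
Proof.
move=> inf; apply: exp_growth_ge => // mu /andP [mu0 mu1] K.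
have [|N HN] := @expr_unbounded _ mu^-1 (K + 1); first by rewrite invf_gt1.
exists N; apply: (@lt_le_trans _ _ 1); last by rewrite ler1n sphere_card_gt0.
rewrite -ltr_pdivlMr ?exprn_gt0 // div1r -exprVn.
by apply: lt_le_trans (HN N (leqnn _)); rewrite ltrDl.
Qed.

Lemma series_denom_root_ge (rho : R) : rho <= 1 ->
  (forall (B : {set V}) t, 0 <= t < rho -> 0 < clique_sum e B (t / (1 + t))) ->
  forall z : R[i], root (series_denom e _ full) z -> toC rho <= `|z|.
Proof.
move=> rho1 pos z; apply: contraTT => h.
have zE := real_complex_ge0 (normr_ge0 z); set r := complex.Re _ in zE.
have r0 : 0 <= r by rewrite -lecR -zE rmorph0.
have rrho : r < rho by rewrite ltNge -lecR -zE.
have r1 : toC r < 1 by rewrite -(rmorph1 toC) ltcR (lt_le_trans rrho).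
have zr : `|z| <= toC r by rewrite zE.
have z1 : 1 + z != 0.
  rewrite addrC addr_eq0; apply: contraTneq r1 => z1.
  by rewrite -zE z1 normrN normr1 ltxx.
have pA : positive_below e (toC r) full.
  by move=> B _; rewrite clique_sum_toC -(rmorph0 toC) ltcR pos // r0.
have [c _ E] := dominated_ratio e_sym zr r1 pA (finset.sub0set _).
rewrite clique_sum0 in E; have {}E := congr1 fst E.
rewrite /root horner_series_denom // mulf_eq0 expf_eq0 (negPf z1) andbF /=.
apply/eqP => Q0; have : (1 : R[i]) = 0; last by move/eqP; rewrite oner_eq0.
have Q0' : (clique_sum e full (z / (1 + z), toC r / (1 + toC r))).1 = 0.
  by rewrite -Q0; exact: (rmorph_clique_sum e fst).
by transitivity (0 * (1 + c).1); [rewrite -Q0'; exact: E | rewrite mul0r].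
Qed.

(** Adding a vertex to [B] gives - x q_L by [clique_sum_del], which is not
positive, hence zero. *)
Lemma zero_upward (rho : R) (B : {set V}) : 0 < rho ->
  (forall B : {set V}, 0 <= clique_sum e B (rho / (1 + rho))) ->
  clique_sum e B (rho / (1 + rho)) = 0 ->
  clique_sum e full (rho / (1 + rho)) = 0.
Proof.
move=> rho0 nn; set x := rho / (1 + rho) in nn *.
have x0 : 0 < x by rewrite divr_gt0 // addr_gt0.
elim: {B}#|~: B| {-2}B (leqnn #|~: B|) => [|n IH] B cB B0.
  suff <- : B = full by [].
  by apply: finset.setC_inj; apply/eqP; rewrite finset.setCT -cards_eq0 -leqn0.
have [BT|/subsetPn [v _ vB]] := boolP (full \subset B).
  suff <- : B = full by [].
  by apply/eqP; rewrite finset.eqEsubset BT finset.subsetT.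
apply: (IH (v |: B)).
  have : (#|~: (v |: B)| < #|~: B|)%N; last by move=> h; rewrite -ltnS (leq_trans h).
  apply: proper_card; apply/properP; split.
    by rewrite finset.setCS finset.subsetUr.
  by exists v; rewrite !inE ?eqxx // vB.
apply: le_anti; rewrite nn andbT (clique_sum_del e_sym x (setU11 v B)).
by rewrite finset.setU1K // B0 sub0r oppr_le0 mulr_ge0 // ltW.
Qed.

(** The conjugates are controlled by the polynomial of a minimal set [A], on
which [unique_zero] applies, instead of that of the whole graph.  A root y of
the former is the inverse of a zero of q_A(t/(1+t)), because
1/(1+y) = t/(1+t) for t = 1/y. *)
Lemma perron_inv_zero (rho : R) : 0 < rho < 1 ->
  (forall B : {set V}, 0 <= clique_sum e B (rho / (1 + rho))) ->
  (exists B : {set V}, clique_sum e B (rho / (1 + rho)) = 0) ->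
  perron rho^-1.
Proof.
move=> /andP [rho0 rho1] nn [B B0].
have rho1' : 1 + rho != 0 by rewrite gt_eqF // addr_gt0.
have recurrence_root (A : {set V}) : clique_sum e A (rho / (1 + rho)) = 0 ->
    root (map_poly intr (recurrence_poly e A)) rho^-1.
  move=> A0; rewrite root_recurrence_poly; last by rewrite gt_eqF // addr_gt0 // invr_gt0.
  apply/eqP; rewrite -A0; congr (clique_sum _ _ _); field.
  by rewrite rho1' gt_eqF.
split; first by rewrite invf_gt1.
  by exists (recurrence_poly e B); [exact: recurrence_poly_monic|exact: recurrence_root].
move=> z [p [_ irr px] py] zx.
pose vanishes (A : {set V}) := clique_sum e A (rho / (1 + rho)) == 0.
have := @arg_minnP _ B vanishes (fun A : {set V} => #|A|) (introT eqP B0).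
case=> A /eqP A0 Amin.
have rz : root (map_poly intr (recurrence_poly e A)) z.
  apply: irreducible_root_transfer irr px _ py.
  have := recurrence_root A A0; rewrite -(fmorph_root toC) -map_poly_comp /=.
  by congr (root _ _); apply: eq_map_poly => i /=; rewrite rmorph_int.
have xn : `|toC rho^-1| = toC rho^-1.
  by rewrite ger0_norm // -(rmorph0 toC) lecR invr_ge0 ltW.
rewrite xn real_ltNge ?ger0_real //; last first.
  by rewrite -(rmorph0 toC) lecR invr_ge0 ltW.
apply/negP => zge; move: zx; apply/negP; rewrite negbK.
have rho0C : 0 < toC rho by rewrite -(rmorph0 toC) ltcR.
have rho1C : toC rho < 1 by rewrite -(rmorph1 toC) ltcR.
have z_gt1 : 1 < `|z|.
  apply: lt_le_trans zge; rewrite -(rmorph1 toC) ltcR invf_gt1 //.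
have z0 : z != 0 by rewrite -normr_gt0 (lt_trans ltr01).
have z1 : 1 + z != 0.
  rewrite addrC addr_eq0; apply: contraTneq z_gt1 => ->.
  by rewrite normrN normr1 ltxx.
have zV : z^-1 = toC rho.
  apply: (unique_zero e_sym (A := A)) => //.
  - rewrite normfV -[rho]invrK fmorphV lef_pV2 // posrE //.
      by rewrite (lt_trans ltr01).
    by rewrite -(rmorph0 toC) ltcR invr_gt0.
  - move=> D DA; rewrite clique_sum_toC -(rmorph0 toC) ltcR.
    rewrite lt_neqAle nn andbT eq_sym; apply/negP => /Amin.
    by rewrite leqNgt proper_card.
  - by rewrite clique_sum_toC A0 rmorph0.
  - move: rz; rewrite root_recurrence_poly // => /eqP rz; rewrite -rz.
    congr (clique_sum _ _ _); field.
    by rewrite z1 z0.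
by apply/eqP; rewrite -[z]invrK zV fmorphV.
Qed.

End Growth.

Local Open Scope classical_set_scope.
Local Open Scope ring_scope.

Theorem theoremA (R : realType) (V : finType) (e : rel V)
    (e_sym : symmetric e) (e_irr : irreflexive e)
    (G_inf : infinite_set [set: racg e]) :
  growth_rate R (racg_gens e) = 1%E \/
  exists2 alpha : R, growth_rate R (racg_gens e) = alpha%:E & perron alpha.
Proof.
have posE (B : {set V}) (t : R) : 0 <= t ->
    (0 < (series_denom e R B).[t]) = (0 < clique_sum e B (t / (1 + t))) /\
    (0 <= (series_denom e R B).[t]) = (0 <= clique_sum e B (t / (1 + t))).
  move=> t0; have t1 : 0 < 1 + t by rewrite ltr_wpDr.
  rewrite horner_series_denom ?gt_eqF //.
  by rewrite pmulr_rgt0 ?exprn_gt0 // pmulr_rge0 ?exprn_gt0.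
have p0 (B : {set V}) : 0 < (series_denom e R B).[0].
  by rewrite (posE B 0 _).1 // mul0r clique_sum_at0 ltr01.
have [pos|[rho rho01 [pos nn [B rB]]]] := least_root p0.
  left; apply: le_anti; apply/andP; split; last exact: sphere_growth_ge1.
  rewrite -[1%R]invr1; apply: sphere_growth_le => //; first by rewrite ltr01 lexx.
  apply: series_denom_root_ge => // B t t01; have /andP [t0 _] := t01.
  by rewrite -(posE B t t0).1 pos.
right; have /andP [rho0 rho1] := rho01; have rho_ge0 := ltW rho0.
have rho1' : 1 + rho != 0 by rewrite gt_eqF // addr_gt0.
have nn' (A : {set V}) : 0 <= clique_sum e A (rho / (1 + rho)).
  by rewrite -(posE A rho rho_ge0).2.
have B0 : clique_sum e B (rho / (1 + rho)) = 0.
  move: rB; rewrite /root horner_series_denom // mulf_eq0 expf_eq0.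
  by rewrite (negPf rho1') andbF => /eqP.
exists rho^-1; last by apply: perron_inv_zero => //; exists B.
apply: le_anti; apply/andP; split.
  apply: sphere_growth_le => //; first by rewrite rho0 ltW.
  apply: series_denom_root_ge => //; first exact: ltW.
  move=> A t trho; have /andP [t0 _] := trho.
  by rewrite -(posE A t t0).1 pos.
apply: sphere_growth_ge => //.
by rewrite /root horner_series_denom // (zero_upward e_sym rho0 nn' B0) mulr0.
Qed.
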